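(* Let $f:\mathbb{R}^n\times\mathbb{R}\to\mathbb{R}^n$ be a given deterministic function, let $L:\mathbb{R}^n\times\mathbb{R}\to\mathbb{R}$ and $c_i:\mathbb{R}^n\times\mathbb{R}\to\mathbb{R}$ ($i=1,\dots,l$) be given functions, and let $\xi\in\mathbb{R}^n$, $\sigma>0$, and $\gamma_{i,k}\in\mathbb{R}$ for $i=1,\dots,l$, $k=0,\dots,N$. For a control sequence $\boldsymbol{u}=(u_0,\dots,u_N)\in\mathbb{R}^{N+1}$ let $x_0=\xi$ and $x_{k+1}=f(x_k,u_k)$ for $k=0,\dots,N$, and consider the problem of minimizing over $\boldsymbol{u}$ the cost function $$\widetilde J(\boldsymbol{u})=\sum_{k=0}^{N}L(x_k,u_k)+\frac{1}{2\sigma}\sum_{i=1}^{l}\sum_{k=0}^{N}\Big\{\big[\max(0,\gamma_{i,k}+\sigma c_i(x_k,u_k))\big]^2-\gamma_{i,k}^2\Big\}.$$ For $k=0,\dots,N$ and $x,\lambda\in\mathbb{R}^n$, $u\in\mathbb{R}$, define $$\mathcal{H}^{(k)}(x,u,\lambda)=L(x,u)+\lambda^{T}f(x,u)+\frac{1}{2\sigma}\sum_{i=1}^{l}\Big\{\big[\max(0,\gamma_{i,k}+\sigma c_i(x,u))\big]^2-\gamma_{i,k}^2\Big\},$$ $$\Phi^{(k)}(x,u,\lambda)=\frac{\partial\mathcal{H}^{(k)}}{\partial u}(x,u,\lambda),\qquad \Psi^{(k)}(x,u,\lambda)=\frac{\partial\mathcal{H}^{(k)}}{\partial x}(x,u,\lambda).$$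 Given $\boldsymbol{u}$ with corresponding states $x_k$, let the costates $\lambda_1,\dots,\lambda_{N+1}\in\mathbb{R}^n$ satisfy $\lambda_{N+1}=\boldsymbol{0}$ and $\lambda_k=\Psi^{(k)}(x_k,u_k,\lambda_{k+1})$ for $k=N,\dots,1$. For $j,k\in\{0,\dots,N\}$ and $x,\lambda,\eta,\mu\in\mathbb{R}^n$, $u\in\mathbb{R}$, define the Hamiltonian $$\mathcal{H}_j^{(k)}(x,u,\lambda,\eta,\mu)=\Phi^{(k)}(x,u,\lambda)\,\boldsymbol{I}_{\{j=k\}}+\eta^{T}f(x,u)+\mu^{T}\Psi^{(k)}(x,u,\lambda).$$ For each $j\in\{0,\dots,N\}$, let the costates $\mu_0,\dots,\mu_N\in\mathbb{R}^n$ and $\eta_1,\dots,\eta_{N+1}\in\mathbb{R}^n$ (depending on $j$) satisfy $$\mu_0=\boldsymbol{0},\qquad \mu_{k+1}=\frac{\partial\mathcal{H}_j^{(k)}}{\partial\lambda}(x_k,u_k,\lambda_{k+1},\eta_{k+1},\mu_k),\quad k=0,\dots,N-1,$$ $$\eta_{N+1}=\boldsymbol{0},\qquad \eta_k=\frac{\partial\mathcal{H}_j^{(k)}}{\partial x}(x_k,u_k,\lambda_{k+1},\eta_{k+1},\mu_k),\quad k=N,\dots,1.$$ Then the Hessian matrix of $\widetilde J$ with respect to $\boldsymbol{u}$ (with $\xi$, $\gamma_{i,k}$, $\sigma$ fixed) is the $(N+1)\times(N+1)$ matrix whose entry in row $j$ and column $k$ ($j,k=0,\dots,N$) is $$\big[\nabla^2\widetilde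 J(\boldsymbol{u})\big]_{j,k}=\frac{\partial\mathcal{H}_j^{(k)}}{\partial u}(x_k,u_k,\lambda_{k+1},\eta_{k+1},\mu_k),$$ where $\eta_{k+1},\mu_k$ are those associated with the row index $j$.
   Context: Partial derivatives of the Hamiltonians are taken treating their arguments $x,u,\lambda,\eta,\mu$ as independent variables and are then evaluated at the indicated point. Derivatives of scalar functions with respect to vectors are regarded as column vectors in $\mathbb{R}^n$. $\boldsymbol{I}_{\{j=k\}}$ equals $1$ if $j=k$ and $0$ otherwise. The function $\widetilde J$ is viewed as a function of the control sequence only, the states $x_k$ being determined by the controls through the forward recursion. It is the augmented Lagrangian, with multipliers $\gamma_{i,k}$ and penalty parameter $\sigma$, of the problem of minimizing $\sum_{k=0}^{N}L(x_k,u_k)$ subject to $c_i(x_k,u_k)\le 0$. Rows and columns of the Hessian are indexed from $0$ to $N$.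
   Formalization: Added assumption: for every k and every λ, the Hamiltonian H^(k)(x,u,λ) is twice (Fréchet) differentiable in (x,u) at (x_k,u_k); the formula can fail if only the written partial derivatives exist. Twice differentiability of the cost at u is then part of the conclusion. *)

(* Defs.v *)
From HB Require Import structures.
From mathcomp Require Import all_boot all_order all_algebra.
From mathcomp Require Import all_classical all_reals all_analysis.

Set Implicit Arguments.
Unset Strict Implicit.
Unset Printing Implicit Defensive.

Import Order.TTheory GRing.Theory Num.Theory.
Import numFieldNormedType.Exports.

Local Open Scope classical_set_scope.
Local Open Scope ring_scope.

Section Calculus.
Context {R : realType}.

Definition gradient {m : nat} (g : 'cV[R]_m -> R) (a : 'cV[R]_m) : 'cV[R]_m :=
  \col_(i < m) 'D_(delta_mx i 0) g a.

(* Row j is the (transposed) gradient of the j-th component of the gradient. *)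
Definition hessian {m : nat} (g : 'cV[R]_m -> R) (a : 'cV[R]_m) : 'M[R]_m :=
  \matrix_(j < m, k < m) (gradient (fun v => gradient g v j 0) a) k 0.

(* The second clause is Fréchet differentiability of the derivative z |-> 'd g z
   when V is finite-dimensional, which is the only case used; it is stated
   direction by direction because {linear V -> W} carries no norm. *)
Definition twice_differentiable {V W : normedModType R} (g : V -> W) (a : V) :
    Prop :=
  (\forall z \near a, differentiable g z) /\
  (forall v : V, differentiable (fun z => 'D_v g z) a).

End Calculus.

Section ControlProblem.
Context {R : realType} {n l N : nat}.
Variables (f : 'cV[R]_n -> R -> 'cV[R]_n) (L : 'cV[R]_n -> R -> R).
Variables (c : 'I_l -> 'cV[R]_n -> R -> R).
Variables (xi : 'cV[R]_n) (sigma : R) (gamma : 'I_l -> 'I_N.+1 -> R).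

(* The controls u_0, ..., u_N are the entries of u; inord k is the index k
   whenever k <= N, so only the values at times 0, ..., N+1 are meaningful. *)
Fixpoint state (u : 'cV[R]_N.+1) (k : nat) : 'cV[R]_n :=
  if k is k'.+1 then f (state u k') (u (inord k') 0) else xi.

Definition penalty (i : 'I_l) (k : 'I_N.+1) (x : 'cV[R]_n) (v : R) : R :=
  Num.max 0 (gamma i k + sigma * c i x v) ^+ 2 - gamma i k ^+ 2.

Definition augmented_cost (u : 'cV[R]_N.+1) : R :=
  \sum_(k < N.+1) L (state u k) (u k 0)
  + (2 * sigma)^-1 *
    \sum_(i < l) \sum_(k < N.+1) penalty i k (state u k) (u k 0).

Definition Ham (k : 'I_N.+1) (x : 'cV[R]_n) (v : R) (lambda : 'cV[R]_n) : R :=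
  L x v + (lambda^T *m f x v) 0 0
  + (2 * sigma)^-1 * \sum_(i < l) penalty i k x v.

Definition Phi (k : 'I_N.+1) (x : 'cV[R]_n) (v : R) (lambda : 'cV[R]_n) : R :=
  derive1 (fun w : R => Ham k x w lambda) v.

Definition Psi (k : 'I_N.+1) (x : 'cV[R]_n) (v : R) (lambda : 'cV[R]_n) :
    'cV[R]_n :=
  gradient (fun y => Ham k y v lambda) x.

Definition Ham2 (j k : 'I_N.+1) (x : 'cV[R]_n) (v : R)
    (lambda eta mu : 'cV[R]_n) : R :=
  Phi k x v lambda * (j == k)%:R
  + (eta^T *m f x v) 0 0 + (mu^T *m Psi k x v lambda) 0 0.

Definition dHam2_x (j k : 'I_N.+1) (x : 'cV[R]_n) (v : R)
    (lambda eta mu : 'cV[R]_n) : 'cV[R]_n :=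
  gradient (fun y => Ham2 j k y v lambda eta mu) x.

Definition dHam2_lambda (j k : 'I_N.+1) (x : 'cV[R]_n) (v : R)
    (lambda eta mu : 'cV[R]_n) : 'cV[R]_n :=
  gradient (fun p => Ham2 j k x v p eta mu) lambda.

Definition dHam2_u (j k : 'I_N.+1) (x : 'cV[R]_n) (v : R)
    (lambda eta mu : 'cV[R]_n) : R :=
  derive1 (fun w : R => Ham2 j k x w lambda eta mu) v.

End ControlProblem.

(* Main.v *)
(** Row j of the Hessian is the gradient of the directional derivative
    D_j J(u) = sum_k DH_k(x_k, u_k)[m_k, I_{j=k}] (H_k taken at lambda = 0),
    which is itself the cost of a control problem whose state is x_k together
    with the sensitivity m_k = D_j x_k = mu_k.  For this problem lambda and eta
    are the costates of m and x.  Concretely, with s_k = D_d x_k and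
    t_k = D_d D_j x_k, the second-order chain rule makes the k-th term of
    D_d D_j J equal to T_k - T_(k+1) + d_k * dH_j^(k)/du, where
    T_k = eta_k . s_k + lambda_k . t_k, and the sum telescopes.  The symmetry of
    second derivatives is never needed. *)

Require Import Defs.
From HB Require Import structures.
From mathcomp Require Import all_boot all_order all_algebra.
From mathcomp Require Import all_classical all_reals all_analysis.
From mathcomp Require Import ring.

Set Implicit Arguments.
Unset Strict Implicit.
Unset Printing Implicit Defensive.

Import Order.TTheory GRing.Theory Num.Theory.
Import numFieldNormedType.Exports.

Local Open Scope classical_set_scope.
Local Open Scope ring_scope.

(** * First-order differential calculus in normed modules *)

Section FirstOrder.
Context {R : realType}.

(** The first-order expansion of [f] at [a] is also one for [g], and differentials are unique. This
    carries differentiability across identities between derivatives that hold only near a point. *)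
Lemma near_eq_differentiable (V W : normedModType R) (f g : V -> W) (a : V) :
  (\near a, f a = g a) -> differentiable f a -> differentiable g a.
Proof.
move=> fg df; have dfg : g \o shift a = cst (g a) + 'd f a +o_ 0 id.
  rewrite -(nbhs_singleton fg); apply/eqaddoP => e e0.
  have /eqaddoP/(_ e e0) := diff_locally df.
  have fg0 : \forall h \near 0, f (h + a) = g (h + a).
    have /= := @near_shift _ _ (0 : V) a (fun z => f z = g z).
    by rewrite subr0 => <-.
  by move: fg0; apply: filterS2 => h fgh; rewrite !fctE /= -fgh.
apply/diff_locallyP; have dgE : 'd g a = 'd f a :> (V -> W).
  by apply: diff_unique => //; exact: diff_continuous.
by rewrite dgE; split => //; exact: diff_continuous.
Qed.

Lemma is_diff_deriveE (V W : normedModType R) (f df : V -> W) (a v : V) :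
  is_diff a f df -> 'D_v f a = df v.
Proof. by move=> dfa; rewrite deriveE // diff_val. Qed.

Lemma is_diff_linear (V W : normedModType R) (f : V -> W) (a : V) :
  linear f -> continuous f -> is_diff a f f.
Proof.
move=> f_lin f_cont.
pose fM := GRing.isLinear.Build _ _ _ _ _ f_lin.
pose fL : {linear V -> W} := HB.pack f fM.
by apply: DiffDef; [exact: (@linear_differentiable _ _ _ fL)
                   |exact: (@diff_lin _ _ _ fL)].
Qed.

(** Scaling is a continuous bilinear map on [R * W], so this product rule is the chain rule through
    its differential. *)
Lemma is_diff_scale (V W : normedModType R) (k dk : V -> R) (g dg : V -> W) a :
  is_diff a k dk -> is_diff a g dg ->
  is_diff a (fun z => k z *: g z) (fun h => k a *: dg h + dk h *: g a).
Proof.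
move=> dka dga.
have sbil : bilinear_for
    (GRing.Scale.Law.clone _ _ *:%R _) (GRing.Scale.Law.clone _ _ *:%R _)
    (@GRing.scale R W).
  by split=> [w|r] b x y /=; rewrite ?scalerDl ?scalerDr ?scalerA // mulrC.
pose sM := bilinear_isBilinear.Build R R W W _ _ (@GRing.scale R W) sbil.
pose sB : {bilinear R -> W -> W} := HB.pack (@GRing.scale R W) sM.
have sc : continuous (fun p : R * W => sB p.1 p.2) by exact: scale_continuous.
have ds p : is_diff p (fun q : R * W => q.1 *: q.2)
    (fun q => p.1 *: q.2 + q.1 *: p.2).
  by apply: DiffDef; [exact: (differentiable_bilin p sc)
                     |exact: (diff_bilin p sc)].
exact: (is_diff_comp (is_diff_pair dka dga) (ds (k a, g a))).
Qed.

Lemma differentiable_cV (V : normedModType R) (m : nat) (g : V -> 'cV[R]_m) a :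
  (forall i, differentiable (fun z => g z i 0) a) -> differentiable g a.
Proof.
move=> dg; have -> : g = \sum_(i < m) (fun z => g z i 0 *: delta_mx i 0).
  apply/funext => z; rewrite fct_sumE {1}[g z]matrix_sum_delta.
  by apply: eq_bigr => i _; rewrite big_ord1.
by apply: differentiable_sum => i; exact: differentiableZl.
Qed.

Lemma derive_cV (V : normedModType R) (m : nat) (g : V -> 'cV[R]_m) a v :
  differentiable g a -> 'D_v g a = \col_i 'D_v (fun z => g z i 0) a.
Proof.
move=> dg; rewrite derive_mx; last exact: diff_derivable.
by apply/matrixP => i j; rewrite !mxE ord1.
Qed.

Lemma near_preimage (V W : normedModType R) (h : V -> W) (a : V)
    (P : set W) :
  differentiable h a -> (\forall y \near h a, P y) ->
  \forall z \near a, P (h z).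
Proof. by move=> /differentiable_continuous ch /ch. Qed.

Lemma derive_comp (U V W : normedModType R) (h : U -> V) (g : V -> W) a v :
  differentiable h a -> differentiable g (h a) ->
  'D_v (g \o h) a = 'D_('D_v h a) g (h a).
Proof.
move=> dh dg; have dgh := differentiable_comp dh dg.
by rewrite !deriveE // diff_comp.
Qed.

Lemma derive_pair (U V W : normedModType R) (g : U -> V) (h : U -> W) a v :
  differentiable g a -> differentiable h a ->
  'D_v (fun z => (g z, h z)) a = ('D_v g a, 'D_v h a).
Proof.
move=> dg dh; have dgh := differentiable_pair dg dh.
by rewrite !deriveE // diff_pair.
Qed.

End FirstOrder.

(** * Twice differentiable maps *)

Section SecondOrder.
Context {R : realType}.

Lemma twice_differentiable_at (V W : normedModType R) (g : V -> W) a :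
  twice_differentiable g a -> differentiable g a.
Proof. by case=> /nbhs_singleton. Qed.

Lemma twice_differentiable_linear (V W : normedModType R) (f : V -> W) a :
  (forall z, is_diff z f f) -> twice_differentiable f a.
Proof.
move=> df; split; first by near=> z; exact: ex_diff.
move=> v; rewrite (_ : (fun z => _) = cst (f v)); first exact: differentiable_cst.
by apply/funext => z; rewrite (is_diff_deriveE _ (df z)).
Unshelve. all: by end_near. Qed.

Lemma twice_differentiable_pair (U V W : normedModType R) (g : U -> V)
    (h : U -> W) a :
  twice_differentiable g a -> twice_differentiable h a ->
  twice_differentiable (fun z => (g z, h z)) a.
Proof.
move=> [dg ddg] [dh ddh]; split.
  by near=> z; apply: differentiable_pair; near: z.
move=> v; apply: (near_eq_differentiable (f := fun z => ('D_v g z, 'D_v h z))).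
  by near=> z; rewrite derive_pair //; near: z.
exact: differentiable_pair.
Unshelve. all: by end_near. Qed.

Lemma twice_differentiableB (V W : normedModType R) (g h : V -> W) a :
  twice_differentiable g a -> twice_differentiable h a ->
  twice_differentiable (g - h) a.
Proof.
move=> [dg ddg] [dh ddh]; split.
  by near=> z; apply: differentiableB; near: z.
move=> v; apply: (near_eq_differentiable (f := 'D_v g - 'D_v h)).
  by near=> z; rewrite deriveB //; apply: diff_derivable; near: z.
exact: differentiableB.
Unshelve. all: by end_near. Qed.

Lemma twice_differentiable_sum (V W : normedModType R) m (g : 'I_m -> V -> W) a :
  (forall i, twice_differentiable (g i) a) ->
  twice_differentiable (\sum_(i < m) g i) a.
Proof.
move=> dg; have dgn : \forall z \near a, forall i, differentiable (g i) z.
  by apply: filter_forall => i; case: (dg i).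
split; first by near=> z; apply: differentiable_sum; near: z.
move=> v; apply: (near_eq_differentiable (f := \sum_(i < m) 'D_v (g i))).
  near=> z; rewrite derive_sum ?fct_sumE // => i; apply: diff_derivable.
  by move: i; near: z.
by apply: differentiable_sum => i; case: (dg i) => _; exact.
Unshelve. all: by end_near. Qed.

Lemma twice_differentiable_cV (V : normedModType R) m (g : V -> 'cV[R]_m) a :
  (forall i, twice_differentiable (fun z => g z i 0) a) ->
  twice_differentiable g a.
Proof.
move=> dg; have dgn : \forall z \near a, differentiable g z.
  have : \forall z \near a, forall i, differentiable (fun z => g z i 0) z.
    by apply: filter_forall => i; case: (dg i).
  by apply: filterS => z; exact: differentiable_cV.
split=> // v; apply: differentiable_cV => i.
apply: (near_eq_differentiable (f := 'D_v (fun z => g z i 0))).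
  by near=> z; rewrite derive_cV ?mxE //; near: z.
by case: (dg i) => _; exact.
Unshelve. all: by end_near. Qed.

Lemma derive2_sum (V W : normedModType R) m (g : 'I_m -> V -> W) a v d :
  (forall i, twice_differentiable (g i) a) ->
  'D_d ('D_v (\sum_(i < m) g i)) a = \sum_(i < m) 'D_d ('D_v (g i)) a.
Proof.
move=> dg; rewrite (near_eq_derive (g := \sum_(i < m) 'D_v (g i))).
  by rewrite derive_sum // => i; apply: diff_derivable; case: (dg i) => _; exact.
have dgn : \forall z \near a, forall i, differentiable (g i) z.
  by apply: filter_forall => i; case: (dg i).
near=> z; rewrite derive_sum ?fct_sumE // => i; apply: diff_derivable.
by move: i; near: z.
Unshelve. all: by end_near. Qed.

(** * Second-order chain rule over a space with finitely many coordinates [phi] along vectors [e] *)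

Section Coordinates.
Context {V : normedModType R} {m : nat}.
Variables (e : 'I_m -> V) (phi : 'I_m -> V -> R).
Hypothesis dphi : forall i a, is_diff a (phi i) (phi i).
Hypothesis phiE : forall v, v = \sum_(i < m) phi i v *: e i.

Lemma derive_coordE (W : normedModType R) (g : V -> W) a v :
  differentiable g a -> 'D_v g a = \sum_(i < m) phi i v *: 'D_(e i) g a.
Proof.
move=> dg; rewrite deriveE // {1}[v]phiE linear_sum.
by apply: eq_bigr => i _; rewrite linearZ deriveE.
Qed.

(* The point and the direction both move: D_(w z) g (h z) is a function of z
   whose differentiability needs finitely many coordinates of w z, since
   twice_differentiable only controls one fixed direction at a time. *)
Lemma is_diff_moving (U W : normedModType R) (g : V -> W) (h w : U -> V) a :
  twice_differentiable g (h a) -> differentiable h a -> differentiable w a ->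
  is_diff a (fun z => 'D_(w z) g (h z))
    (fun d => 'D_('D_d h a) ('D_(w a) g) (h a) + 'D_('D_d w a) g (h a)).
Proof.
move=> [dg ddg] dh dw.
have dgn : \forall z \near a, differentiable g (h z).
  exact: near_preimage dh dg.
have dga := nbhs_singleton dg.
(* Expanding the moving direction [w z] in coordinates leaves only the fixed directions [e i], to
   which [ddg] applies. *)
pose s := \sum_(i < m) (fun z => phi i (w z) *: 'D_(e i) g (h z)).
have dgi i : differentiable ('D_(e i) g) (h a) by exact: ddg.
have dsi i : is_diff a (fun z => phi i (w z) *: 'D_(e i) g (h z))
    (fun d => phi i (w a) *: 'D_('D_d h a) ('D_(e i) g) (h a)
              + phi i ('D_d w a) *: 'D_(e i) g (h a)).
  have dphiw : is_diff a (phi i \o w) (phi i \o 'd w a).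
    exact: (is_diff_comp (differentiableP dw)).
  have dgh : is_diff a ('D_(e i) g \o h) ('d ('D_(e i) g) (h a) \o 'd h a).
    exact: (is_diff_comp (differentiableP dh) (differentiableP (dgi i))).
  apply: (is_diff_eq (is_diff_scale dphiw dgh)).
  by apply/funext => d /=; rewrite !deriveE.
have sE : \near a, s a = 'D_(w a) g (h a).
  near=> z; rewrite /s fct_sumE (@derive_coordE _ _ (h z)) //; near: z.
  exact: dgn.
have ds : differentiable s a by apply: differentiable_sum => i; exact: ex_diff.
have dD : differentiable (fun z => 'D_(w z) g (h z)) a.
  exact: near_eq_differentiable ds.
apply: DiffDef => //; apply/funext => d; rewrite -deriveE //.
rewrite -(near_eq_derive _ sE) derive_sum; last first.
  by move=> i; apply: diff_derivable; exact: ex_diff.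
rewrite (eq_bigr _ (fun i _ => is_diff_deriveE d (dsi i))).
rewrite big_split /= -(derive_coordE _ dga); congr (_ + _).
(* With the coefficients frozen at [phi i (w a)], the second derivatives along the [e i] reassemble
   into the derivative of the single map ['D_(w a) g]. *)
have wE : \forall y \near h a,
    (\sum_(i < m) phi i (w a) *: 'D_(e i) g) y = 'D_(w a) g y.
  near=> y; rewrite fct_sumE (@derive_coordE _ _ y) //; near: y; exact: dg.
rewrite -(near_eq_derive _ wE) derive_sum; last first.
  by move=> i; apply: diff_derivable; apply: differentiableZ.
by apply: eq_bigr => i _; rewrite deriveZ //; exact: diff_derivable.
Unshelve. all: by end_near. Qed.

(** The chain rule holds on a whole neighbourhood of [a], so both sides can be differentiated once
    more. *)
Lemma near_derive_comp (U W : normedModType R) (h : U -> V) (g : V -> W) a v :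
  twice_differentiable h a -> twice_differentiable g (h a) ->
  \forall z \near a, 'D_('D_v h z) g (h z) = 'D_v (g \o h) z.
Proof.
move=> th [dg _]; have [dh _] := th.
have dgn : \forall z \near a, differentiable g (h z).
  exact: near_preimage (twice_differentiable_at th) dg.
by near=> z; rewrite derive_comp //; near: z.
Unshelve. all: by end_near. Qed.

(** Near [a], ['D_v (g \o h)] is a derivative of [g] at the moving point [h z] in the moving
    direction ['D_v h z], which is the situation of [is_diff_moving]. *)
Lemma twice_differentiable_comp (U W : normedModType R) (h : U -> V)
    (g : V -> W) a :
  twice_differentiable h a -> twice_differentiable g (h a) ->
  twice_differentiable (g \o h) a.
Proof.
move=> th tg; have [dh ddh] := th; have [dg _] := tg.
have dha := twice_differentiable_at th; split.
  have dgn : \forall z \near a, differentiable g (h z).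
    exact: near_preimage dha dg.
  by near=> z; apply: differentiable_comp; near: z.
move=> v; apply: (near_eq_differentiable (near_derive_comp v th tg)).
by have [] := is_diff_moving tg dha (ddh v).
Unshelve. all: by end_near. Qed.

Lemma derive2_comp (U W : normedModType R) (h : U -> V) (g : V -> W) a v d :
  twice_differentiable h a -> twice_differentiable g (h a) ->
  'D_d ('D_v (g \o h)) a =
  'D_('D_d h a) ('D_('D_v h a) g) (h a) + 'D_('D_d ('D_v h) a) g (h a).
Proof.
move=> th tg; have dha := twice_differentiable_at th; have [_ ddh] := th.
rewrite -(near_eq_derive d (near_derive_comp v th tg)).
exact: (is_diff_deriveE _ (is_diff_moving tg dha (ddh v))).
Qed.

End Coordinates.
End SecondOrder.

(** * Column vectors and the joint state-control space *)

Section ColumnVectors.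
Context {R : realType} {n : nat}.

Definition dot (p w : 'cV[R]_n) : R := (p^T *m w) 0 0.

Lemma dotE p w : dot p w = \sum_i p i 0 * w i 0.
Proof. by rewrite /dot mxE; under eq_bigr do rewrite mxE. Qed.

Lemma dotC p w : dot p w = dot w p.
Proof. by rewrite !dotE; apply: eq_bigr => i _; rewrite mulrC. Qed.

Lemma dot_linear p : linear (dot p).
Proof. by move=> b v w; rewrite /dot linearP /= !mxE. Qed.

Lemma dotD p v w : dot p (v + w) = dot p v + dot p w.
Proof. by have := dot_linear p 1 v w; rewrite !scale1r. Qed.

Lemma dot0 p : dot p 0 = 0.
Proof. by rewrite /dot mulmx0 mxE. Qed.

Lemma dot0l w : dot 0 w = 0.
Proof. by rewrite dotC dot0. Qed.

Lemma dot_delta w i : dot w (delta_mx i 0) = w i 0.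
Proof. by rewrite /dot -colE !mxE. Qed.

Lemma is_diff_coord (i : 'I_n) (a : 'cV[R]_n) :
  is_diff a (fun w : 'cV[R]_n => w i 0) (fun w : 'cV[R]_n => w i 0).
Proof.
apply: is_diff_linear; first by move=> b v w; rewrite !mxE.
exact: coord_continuous.
Qed.

Lemma is_diff_dot p a : is_diff a (dot p) (dot p).
Proof.
apply: is_diff_linear; first exact: dot_linear.
move=> b; apply: differentiable_continuous.
rewrite (_ : dot p = \sum_i (p i 0 *: fun w : 'cV[R]_n => w i 0)).
  apply: differentiable_sum => i; apply: differentiableZ.
  exact: differentiable_coord.
by apply/funext => w; rewrite dotE fct_sumE.
Qed.

Lemma is_diff_fst (W : normedModType R) (a : 'cV[R]_n * W) : is_diff a fst fst.
Proof. by apply: is_diff_linear => // b; exact: cvg_fst. Qed.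

Lemma is_diff_snd (W : normedModType R) (a : 'cV[R]_n * W) : is_diff a snd snd.
Proof. by apply: is_diff_linear => // b; exact: cvg_snd. Qed.

Lemma differentiable_dot (V : normedModType R) (g : V -> 'cV[R]_n) p a :
  differentiable g a -> differentiable (fun z => dot p (g z)) a.
Proof.
move=> dg; have dp := is_diff_dot p (g a).
exact: (differentiable_comp (g := dot p) dg).
Qed.

Lemma derive_dot (V : normedModType R) (g : V -> 'cV[R]_n) p a v :
  differentiable g a -> 'D_v (fun z => dot p (g z)) a = dot p ('D_v g a).
Proof.
move=> dg; have dp := is_diff_dot p (g a).
by rewrite (derive_comp (g := dot p)) // (is_diff_deriveE _ dp).
Qed.

(** The standard basis of the state-control space, the last index being the control. With
    [pair_coord] it instantiates [e] and [phi] of the chain rule. *)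
Definition pair_basis (i : 'I_(n + 1)) : 'cV[R]_n * R :=
  match fintype.split i with inl a => (delta_mx a 0, 0) | inr _ => (0, 1) end.

Definition pair_coord (i : 'I_(n + 1)) (z : 'cV[R]_n * R) : R :=
  match fintype.split i with inl a => z.1 a 0 | inr _ => z.2 end.

Lemma is_diff_pair_coord i a : is_diff a (pair_coord i) (pair_coord i).
Proof.
rewrite /pair_coord; case: fintype.split => [b|_]; last exact: is_diff_snd.
exact: (is_diff_comp (is_diff_fst a) (is_diff_coord b a.1)).
Qed.

Lemma pair_coordE z : z = \sum_i pair_coord i z *: pair_basis i.
Proof.
have sl (i : 'I_n) : fintype.split (lshift 1 i) = inl i := unsplitK (inl i).
have sr (i : 'I_1) : fintype.split (rshift n i) = inr i := unsplitK (inr i).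
rewrite big_split_ord big_ord1 /pair_coord /pair_basis sr.
under eq_bigr do rewrite sl.
case: z => x v /=; apply: injective_projections => /=.
  rewrite raddf_sum /= scaler0 addr0 {1}[x]matrix_sum_delta.
  by apply: eq_bigr => i _; rewrite big_ord1.
by rewrite raddf_sum /= big1 ?add0r => [|i _]; rewrite ?scaler0 // [_ *: _]mulr1.
Qed.

Lemma derive1_snd (W : normedModType R) (g : 'cV[R]_n * R -> W) x v :
  derive1 (fun w => g (x, w)) v = 'D_(0, 1) g (x, v).
Proof.
have shift_snd h : h *: (0, 1) + (x, v) = (x, h *: 1 + v) :> 'cV[R]_n * R.
  by congr (_, _); rewrite /= scaler0 add0r.
by rewrite derive1E /derive; under [in RHS]eq_fun do rewrite /= shift_snd.
Qed.

Lemma derive_fst (W : normedModType R) (g : 'cV[R]_n * R -> W) x v d :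
  'D_d (fun y => g (y, v)) x = 'D_(d, 0) g (x, v).
Proof.
have shift_fst h : h *: (d, 0) + (x, v) = (h *: d + x, v) :> 'cV[R]_n * R.
  by congr (_, _); rewrite /= scaler0 add0r.
by rewrite /derive; under [in RHS]eq_fun do rewrite /= shift_fst.
Qed.

Lemma dot_gradient (g : 'cV[R]_n -> R) a d :
  differentiable g a -> dot (gradient g a) d = 'D_d g a.
Proof.
move=> dg; rewrite dotE deriveE // {2}[d]matrix_sum_delta linear_sum.
apply: eq_bigr => i _; by rewrite big_ord1 linearZ mxE deriveE // mulrC.
Qed.

(** The bridge between the partial derivatives that define theHamiltonian systems and the
    directional derivatives on the joint space that the chain rule produces. *)
Lemma derive_partials (g : 'cV[R]_n * R -> R) x v d w :
  differentiable g (x, v) ->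
  'D_(d, w) g (x, v) =
  dot (gradient (fun y => g (y, v)) x) d + w * derive1 (fun t => g (x, t)) v.
Proof.
move=> dg; rewrite dot_gradient; last first.
  have dx : is_diff x (fun y : 'cV[R]_n => (y, v)) (fun y => (y, 0)).
    by apply: is_diff_pair.
  exact: (differentiable_comp (f := fun y => (y, v)) (g := g)).
rewrite derive_fst derive1_snd !deriveE // -[w * _]/(w *: _) -linearZ -linearD.
by congr ('d _ _ (_, _)); rewrite /= ?scaler0 ?addr0 ?add0r // [_ *: _]mulr1.
Qed.

End ColumnVectors.

(** * Derivatives of the two Hamiltonians *)

Section Hamiltonians.
Context {R : realType} {n l N : nat}.
Variables (f : 'cV[R]_n -> R -> 'cV[R]_n) (L : 'cV[R]_n -> R -> R).
Variables (c : 'I_l -> 'cV[R]_n -> R -> R).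
Variables (sigma : R) (gamma : 'I_l -> 'I_N.+1 -> R).

Local Notation H k p :=
  (fun z : 'cV[R]_n * R => Ham f L c sigma gamma k z.1 z.2 p).
Local Notation F := (fun z : 'cV[R]_n * R => f z.1 z.2).
Local Notation Psi := (Psi f L c sigma gamma).
Local Notation Ham2 := (Ham2 f L c sigma gamma).

Lemma HamE k p x v : Ham f L c sigma gamma k x v p =
  Ham f L c sigma gamma k x v 0 + dot p (f x v).
Proof. by rewrite /Ham -/(dot _ _) -/(dot _ _) dot0l addr0 addrAC. Qed.

(** The Hamiltonian is affine in [p] with slope [f], so component [i] of [f] is its value at the
    [i]-th unit vector minus its value at 0. *)
Lemma twice_differentiable_dynamics k a :
  (forall p, twice_differentiable (H k p) a) -> twice_differentiable F a.
Proof.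
move=> tH; apply: twice_differentiable_cV => i.
rewrite (_ : (fun z => _) = H k (delta_mx i 0) - H k 0).
  exact: twice_differentiableB.
apply/funext => z; rewrite !fctE HamE [_ + dot _ _]addrC addrK.
by rewrite dotC dot_delta.
Qed.

Lemma derive_Ham k p a w : differentiable (H k 0) a -> differentiable F a ->
  'D_w (H k p) a = 'D_w (H k 0) a + dot p ('D_w F a).
Proof.
move=> dG dF; rewrite -derive_dot // -deriveD; first last.
- by apply: diff_derivable; exact: differentiable_dot.
- exact: diff_derivable.
by congr ('D_w _ a); apply/funext => z; rewrite HamE.
Qed.

(** Allows the cost terms, which are Hamiltonians at costate 0, to be traded for Hamiltonians at the
    actual costate. *)
Lemma derive2_Ham k p a v w : (forall q, twice_differentiable (H k q) a) ->
  'D_w ('D_v (H k p)) a = 'D_w ('D_v (H k 0)) a + dot p ('D_w ('D_v F) a).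
Proof.
move=> tH; have tF := twice_differentiable_dynamics tH.
have [dG ddG] := tH 0; have [dF ddF] := tF.
rewrite -derive_dot // -deriveD; first last.
- by apply: diff_derivable; exact: differentiable_dot.
- exact: diff_derivable.
apply: near_eq_derive; near=> z; rewrite derive_Ham //; near: z => //.
Unshelve. all: by end_near. Qed.

Lemma dot_Psi k x v p d : differentiable (H k p) (x, v) ->
  dot (Psi k x v p) d = 'D_(d, 0) (H k p) (x, v).
Proof. by move=> dH; rewrite derive_partials // mul0r addr0. Qed.

(** The key reading of the second Hamiltonian: its [Phi] and [Psi] terms together form one
    directional derivative of the first, along the variation [mu] of the state and the variation
    [(j == k)%:R] of the control. *)
Lemma Ham2E j k x v p eta mu : differentiable (H k p) (x, v) ->
  Ham2 j k x v p eta mu =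
  'D_(mu, (j == k)%:R) (H k p) (x, v) + dot eta (f x v).
Proof.
move=> dH; rewrite derive_partials // /Defs.Ham2 -!/(dot _ _).
by rewrite [LHS]addrAC; congr (_ + _); rewrite addrC dotC mulrC.
Qed.

(** By [Ham2E] the second Hamiltonian is affine in the costate, and its slope is the linearized
    dynamics. Hence the recursion for [mu] is that of the state sensitivity. *)
Lemma dHam2_lambdaE j k x v p eta mu :
  (forall q, differentiable (H k q) (x, v)) -> differentiable F (x, v) ->
  dHam2_lambda f L c sigma gamma j k x v p eta mu =
  'D_(mu, (j == k)%:R) F (x, v).
Proof.
move=> dH dF; set w := 'D__ _ _; apply/matrixP => i i'; rewrite ord1 mxE.
rewrite (_ : (fun q => _) = cst ('D_(mu, (j == k)%:R) (H k 0) (x, v)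
    + dot eta (f x v)) + dot w).
  have dw := is_diff_dot w p.
  rewrite deriveD //; last exact: diff_derivable.
  by rewrite derive_cst add0r (is_diff_deriveE _ dw) dot_delta.
apply/funext => q; rewrite Ham2E // derive_Ham // addrAC.
by rewrite [dot q _]dotC.
Qed.

(** Differentiates [Ham2E], which holds near the point, along [(d, w)]. With [(d, w)] the variation
    of state and control, this produces the second-order part of the chain rule. *)
Lemma dHam2_direction j k x v p eta mu d w :
  (forall q, twice_differentiable (H k q) (x, v)) ->
  dot (dHam2_x f L c sigma gamma j k x v p eta mu) d
  + w * dHam2_u f L c sigma gamma j k x v p eta mu =
  'D_(d, w) ('D_(mu, (j == k)%:R) (H k p)) (x, v) + dot eta ('D_(d, w) F (x, v)).
Proof.
move=> tH; have [dH ddH] := tH p.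
have dF := twice_differentiable_at (twice_differentiable_dynamics tH).
pose K z := Ham2 j k z.1 z.2 p eta mu.
have KE : \forall z \near (x, v),
    ('D_(mu, (j == k)%:R) (H k p) + (fun z => dot eta (F z))) z = K z.
  by near=> z; rewrite /K Ham2E -?surjective_pairing //; near: z.
have dS : differentiable
    ('D_(mu, (j == k)%:R) (H k p) + (fun z => dot eta (F z))) (x, v).
  by apply: differentiableD => //; exact: differentiable_dot.
have dK : differentiable K (x, v) := near_eq_differentiable KE dS.
rewrite -(derive_partials (g := K)) // -(near_eq_derive _ KE) deriveD.
- by rewrite derive_dot.
- exact: diff_derivable.
- by apply: diff_derivable; exact: differentiable_dot.
Unshelve. all: by end_near. Qed.

End Hamiltonians.

(** * First and second variations of the trajectory *)

Section Trajectory.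
Context {R : realType} {n N : nat}.
Variables (f : 'cV[R]_n -> R -> 'cV[R]_n) (xi : 'cV[R]_n) (u : 'cV[R]_N.+1).

Local Notation F := (fun z : 'cV[R]_n * R => f z.1 z.2).
Local Notation x k := (fun z : 'cV[R]_N.+1 => state f xi z k).

(** Taken as a map of the whole control sequence, so that the next state and each cost term are
    functions of state and control composed with it. *)
Definition stage (k : nat) (z : 'cV[R]_N.+1) : 'cV[R]_n * R :=
  (state f xi z k, z (inord k) 0).

Lemma twice_differentiable_stage k : twice_differentiable (x k) u ->
  twice_differentiable (stage k) u.
Proof.
move=> tx; apply: twice_differentiable_pair => //.
by apply: twice_differentiable_linear => z; exact: is_diff_coord.
Qed.

Hypothesis tF : forall k, (k <= N)%N -> twice_differentiable F (stage k u).

(** The state at [k.+1] is [F] composed with [stage k], so the chain rule propagates regularity from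
    the constant initial state. *)
Lemma twice_differentiable_state k : (k <= N.+1)%N ->
  twice_differentiable (x k) u.
Proof.
elim: k => [|k IHk] kN.
  split=> [|v]; first by near=> z; exact: (differentiable_cst xi).
  have -> : (fun z => 'D_v (x 0) z) = cst 0; last exact: differentiable_cst.
  by apply/funext => z; exact: derive_cst.
have tx := IHk (ltnW kN).
exact: (twice_differentiable_comp (g := F) is_diff_pair_coord pair_coordE
  (twice_differentiable_stage tx) (tF kN)).
Unshelve. all: by end_near. Qed.

Lemma derive_stage k z v : differentiable (x k) z ->
  'D_v (stage k) z = ('D_v (x k) z, v (inord k) 0).
Proof.
move=> dx; have du := is_diff_coord (inord k) z.
by rewrite derive_pair // (is_diff_deriveE v du).
Qed.

(** The second component vanishes because the control is a linear coordinate of the control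
    sequence. *)
Lemma derive2_stage k v d : (k <= N.+1)%N ->
  'D_d ('D_v (stage k)) u = ('D_d ('D_v (x k)) u, 0).
Proof.
move=> kN; have [dx ddx] := twice_differentiable_state kN.
rewrite (near_eq_derive (g := fun z => ('D_v (x k) z, v (inord k) 0))).
  by rewrite derive_pair // derive_cst.
by near=> z; rewrite derive_stage //; near: z.
Unshelve. all: by end_near. Qed.

Lemma derive_state0 z v : 'D_v (x 0) z = 0.
Proof. exact: derive_cst. Qed.

Lemma derive2_state0 z v d : 'D_d ('D_v (x 0)) z = 0.
Proof.
rewrite (_ : 'D_v (x 0) = cst 0); first exact: derive_cst.
by apply/funext => w; exact: derive_state0.
Qed.

Lemma derive_stateS k v : (k <= N)%N ->
  'D_v (x k.+1) u = 'D_('D_v (x k) u, v (inord k) 0) F (stage k u).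
Proof.
move=> kN; have tx := twice_differentiable_state (leqW kN).
have ty := twice_differentiable_stage tx.
rewrite -derive_stage; last exact: twice_differentiable_at.
exact: (derive_comp (h := stage k) (g := F) v (twice_differentiable_at ty)
  (twice_differentiable_at (tF kN))).
Qed.

(** Serves twice: with the dynamics for the second variation of the state, and with the Hamiltonian
    at costate 0 for a term of the cost. *)
Lemma derive2_comp_stage (W : normedModType R) (g : 'cV[R]_n * R -> W) k v d :
  (k <= N)%N -> twice_differentiable g (stage k u) ->
  'D_d ('D_v (g \o stage k)) u =
  'D_('D_d (x k) u, d (inord k) 0)
    ('D_('D_v (x k) u, v (inord k) 0) g) (stage k u)
  + 'D_('D_d ('D_v (x k)) u, 0) g (stage k u).
Proof.
move=> kN tg; have tx := twice_differentiable_state (leqW kN).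
have dx := twice_differentiable_at tx.
rewrite (derive2_comp is_diff_pair_coord pair_coordE v d
  (twice_differentiable_stage tx) tg).
by rewrite !derive_stage // derive2_stage // leqW.
Qed.

Lemma derive2_stateS k v d : (k <= N)%N ->
  'D_d ('D_v (x k.+1)) u =
  'D_('D_d (x k) u, d (inord k) 0)
    ('D_('D_v (x k) u, v (inord k) 0) F) (stage k u)
  + 'D_('D_d ('D_v (x k)) u, 0) F (stage k u).
Proof. by move=> kN; rewrite -derive2_comp_stage //; exact: tF. Qed.

End Trajectory.

(** * The Hessian of the augmented cost *)

Theorem theorem2 (R : realType) (n l N : nat)
    (f : 'cV[R]_n -> R -> 'cV[R]_n) (L : 'cV[R]_n -> R -> R)
    (c : 'I_l -> 'cV[R]_n -> R -> R)
    (xi : 'cV[R]_n) (sigma : R) (gamma : 'I_l -> 'I_N.+1 -> R)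
    (u : 'cV[R]_N.+1)
    (lambda : nat -> 'cV[R]_n) (eta mu : 'I_N.+1 -> nat -> 'cV[R]_n) :
  let x := state f xi u in
  0 < sigma ->
  (* the first- and second-order derivatives of the Hamiltonians exist along
     the trajectory *)
  (forall (k : 'I_N.+1) (p : 'cV[R]_n),
     twice_differentiable
       (fun z : 'cV[R]_n * R => Ham f L c sigma gamma k z.1 z.2 p)
       (x k, u k 0)) ->
  lambda N.+1 = 0 ->
  (forall k : 'I_N.+1, (0 < k)%N ->
     lambda k = Psi f L c sigma gamma k (x k) (u k 0) (lambda k.+1)) ->
  (forall j : 'I_N.+1, mu j 0%N = 0) ->
  (forall j k : 'I_N.+1, (k < N)%N ->
     mu j k.+1 = dHam2_lambda f L c sigma gamma j k
                   (x k) (u k 0) (lambda k.+1) (eta j k.+1) (mu j k)) ->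
  (forall j : 'I_N.+1, eta j N.+1 = 0) ->
  (forall j k : 'I_N.+1, (0 < k)%N ->
     eta j k = dHam2_x f L c sigma gamma j k
                 (x k) (u k 0) (lambda k.+1) (eta j k.+1) (mu j k)) ->
  twice_differentiable (augmented_cost f L c xi sigma gamma) u /\
  hessian (augmented_cost f L c xi sigma gamma) u =
    \matrix_(j < N.+1, k < N.+1)
      dHam2_u f L c sigma gamma j k
        (x k) (u k 0) (lambda k.+1) (eta j k.+1) (mu j k).
Proof.
set x := state f xi u => /= sigma0 tH lamN lamE mu0 muE etaN etaE.
pose H k p := fun z : 'cV[R]_n * R => Ham f L c sigma gamma k z.1 z.2 p.
pose F := fun z : 'cV[R]_n * R => f z.1 z.2.
have stageE (k : 'I_N.+1) : stage f xi k u = (x k, u k 0).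
  by rewrite /stage inord_val.
have tF k : (k <= N)%N -> twice_differentiable F (stage f xi k u).
  move=> kN; have -> : k = @inord N k by rewrite inordK.
  rewrite stageE.
  exact: (twice_differentiable_dynamics (tH (inord k))).
have tcost (k : 'I_N.+1) : twice_differentiable (H k 0 \o stage f xi k) u.
  apply: (twice_differentiable_comp is_diff_pair_coord pair_coordE).
    apply: twice_differentiable_stage; apply: twice_differentiable_state tF _ _.
    exact: ltnW.
  by rewrite stageE; exact: tH.
(* At costate 0 the Hamiltonian is the running cost plus the penalties of that time, once the two
   penalty sums are exchanged. *)
have costE : augmented_cost f L c xi sigma gamma =
    \sum_(k < N.+1) (H k 0 \o stage f xi k).
  apply/funext => z; rewrite fct_sumE /augmented_cost exchange_big mulr_sumr.
  rewrite -big_split; apply: eq_bigr => k _ /=.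
  by rewrite /H /stage /Ham /= inord_val trmx0 mul0mx mxE addr0.
rewrite costE; split; first exact: twice_differentiable_sum.
apply/matrixP => j k0; rewrite !mxE.
under eq_fun do rewrite mxE.
rewrite derive2_sum //.
(* [v] is the row direction and [d] the column direction; the row derivative is taken first. *)
pose v : 'cV[R]_N.+1 := delta_mx j 0; pose d : 'cV[R]_N.+1 := delta_mx k0 0.
pose xs k := fun z : 'cV[R]_N.+1 => state f xi z k.
pose s k := 'D_d (xs k) u; pose t k := 'D_d ('D_v (xs k)) u.
have muS k : (k <= N)%N -> mu j k = 'D_v (xs k) u.
  elim: k => [|k IHk] kN; first by rewrite mu0 [RHS]derive_state0.
  (* Costates are indexed by naturals but Hamiltonians by ordinals; [k'] is time [k] as an
     ordinal. *)
  have kN' := ltnW kN; pose k' := @inord N k; have kE : k = k' by rewrite inordK.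
  rewrite [RHS](derive_stateS tF) // -/(xs k) -IHk // kE muE -kE //.
  have tHk := tH k'; rewrite -stageE -kE in tHk.
  rewrite [LHS]dHam2_lambdaE //; last 2 first.
  - by move=> q; rewrite -[x k]/(x k) kE; exact: twice_differentiable_at.
  - rewrite kE; apply: twice_differentiable_at.
    exact: twice_differentiable_dynamics (tH k').
  by rewrite mxE andbT /stage eq_sym.
pose T k := dot (eta j k) (s k) + dot (lambda k) (t k).
have stepE (k : 'I_N.+1) : 'D_d ('D_v (H k 0 \o stage f xi k)) u =
    T k - T k.+1 + (k == k0)%:R * dHam2_u f L c sigma gamma j k
      (x k) (u k 0) (lambda k.+1) (eta j k.+1) (mu j k).
  have kN : (k <= N)%N by rewrite -ltnS.
  rewrite (derive2_comp_stage tF) // ?stageE; last exact: tH.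
  rewrite -/(xs k) -/(s k) -/(t k) -muS //.
  have sS : s k.+1 = 'D_(s k, d k 0) F (x k, u k 0).
    by rewrite /s (derive_stateS tF) // stageE inord_val.
  have tS : t k.+1 = 'D_(s k, d k 0) ('D_(mu j k, v k 0) F) (x k, u k 0)
      + 'D_(t k, 0) F (x k, u k 0).
    by rewrite /t (derive2_stateS tF) // stageE inord_val -muS.
  (* The recursions for [eta] and [lambda] stop at time 1, so their values at time 0 are arbitrary.
     The paired identities still hold there because the initial state is fixed, which makes [s 0]
     and [t 0] vanish. *)
  have etas : dot (dHam2_x f L c sigma gamma j k (x k) (u k 0) (lambda k.+1)
      (eta j k.+1) (mu j k)) (s k) = dot (eta j k) (s k).
    case: (posnP k) => [k0E|kpos]; last by rewrite etaE.
    by rewrite k0E /s derive_state0 !dot0.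
  have lamt : dot (Psi f L c sigma gamma k (x k) (u k 0) (lambda k.+1)) (t k)
      = dot (lambda k) (t k).
    case: (posnP k) => [k0E|kpos]; last by rewrite lamE.
    by rewrite k0E /t derive2_state0 !dot0.
  have vk : v k 0 = (j == k)%:R by rewrite mxE andbT eq_sym.
  have dk : d k 0 = (k == k0)%:R by rewrite mxE andbT.
  have := dHam2_direction j (lambda k.+1) (eta j k.+1) (mu j k) (s k) (d k 0)
    (tH k).
  (* Passing from costate [lambda k.+1] to costate 0 leaves corrections involving the derivatives of
     [F]; together they are the product of [lambda k.+1] with [t k.+1]. *)
  rewrite derive2_Ham; last exact: tH.
  have := dot_Psi (t k) (twice_differentiable_at (tH k (lambda k.+1))).
  rewrite derive_Ham ?etas ?lamt; first last.
  - exact: (twice_differentiable_at (twice_differentiable_dynamics (tH k))).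
  - exact: twice_differentiable_at.
  rewrite /T sS tS dotD inord_val -dk -vk => -> Eeta.
  (* Adding and subtracting the control term exposes the left side of [Eeta]. *)
  rewrite -[dot (eta j k) (s k)](addrK (d k 0 * dHam2_u f L c sigma gamma j k
      (x k) (u k 0) (lambda k.+1) (eta j k.+1) (mu j k))) Eeta.
  by ring.
rewrite (eq_bigr _ (fun k _ => stepE k)) big_split /= addrC.
(* Since [d] is a unit vector, only time [k0] contributes a control derivative. *)
rewrite (bigD1 k0) //= eqxx mul1r big1 ?addr0 => [|k /negPf ->]; last exact: mul0r.
rewrite -(big_mkord predT (fun k => T k - T k.+1)).
under eq_bigr do rewrite -opprB.
(* The boundary terms vanish: [T N.+1] by the terminal costates, [T 0] by the zero variations of the
   initial state. *)
rewrite sumrN telescope_sumr // /T lamN etaN !dot0l.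
by rewrite /s /t derive_state0 derive2_state0 !dot0 !addr0 subrr oppr0 addr0.
Qed.
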